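(* Let $\mathbb{P}$ be a logic program. For all objects $n,m$ of $\mathbf{L}$, all atoms $A\in At(n)$ and all substitutions $\theta\in\mathbf{L}[n,m]$, $$[\![A\theta]\!]_{p^\sharp}=[\![A]\!]_{p^\sharp}\,\overline{\theta},$$ where $[\![\cdot]\!]_{p^\sharp}:At\to\Omega$ is the saturated semantics of $\mathbb{P}$ and $T\overline{\theta}$ denotes $\Omega(\theta)(T)$ for $T\in\Omega(n)$.
   Context: Fix a signature $\Sigma$ (at most countable) and predicate symbols with arities. $\mathbf{L}$ denotes $\mathbf{L}_\Sigma^{op}$, the (opposite) Lawvere theory of $\Sigma$: objects are natural numbers; an arrow (substitution) $n\to m$ is an $n$-tuple $\langle t_1,\dots,t_n\rangle$ of $\Sigma$-terms with variables among $x_1,\dots,x_m$; $id_n=\langle x_1,\dots,x_n\rangle$; for $\theta=\langle t_1,\dots,t_n\rangle:n\to m$ and $\sigma=\langle s_1,\dots,s_m\rangle:m\to m'$, $\sigma\circ\theta$ is obtained by replacing each $x_j$ by $s_j$ in every $t_i$. $|\mathbf{L}|$ is the discrete category on the objects of $\mathbf{L}$. The presheaf $At:\mathbf{L}\to\mathbf{Set}$ maps $n$ to the set of atoms $P(t_1,\dots,t_r)$ with variables among $x_1,\dots,x_n$, and $At(\theta)(A)=A\theta$ (apply the substitution). A logic program $\mathbb{P}$ is a finite set of clauses $H\leftarrow B_1,\dots,B_k$ ($k\ge 0$) with $H,B_i$ atoms. $\mathcal{P}_c$, $\mathcal{P}_f$ are the (covariant) countable and finite powerset functors on $\mathbf{Set}$;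 $\widehat{\mathcal{P}_c},\widehat{\mathcal{P}_f}$ are their extensions to $\mathbf{Set}^{|\mathbf{L}|}$ by postcomposition. $\mathcal{U}:\mathbf{Set}^{\mathbf{L}}\to\mathbf{Set}^{|\mathbf{L}|}$ is the forgetful functor (precomposition with the inclusion), with right adjoint $\mathcal{K}$ given by $\mathcal{K}(F)(n)=\prod_{\theta:n\to m}F(m)$ (product over all arrows $\theta$ of $\mathbf{L}$ with source $n$, $m$ being the target of $\theta$), $\mathcal{K}(F)(\theta)(\dot x)=\langle\dot x(\sigma\circ\theta)\rangle_{\sigma:m\to m'}$ for $\theta:n\to m$, and acting indexwise on natural transformations. The unit is $\eta_G(n)(x)=\langle G(\theta)(x)\rangle_{\theta:n\to m}$. The program yields $p:\mathcal{U}At\to\widehat{\mathcal{P}_c}\widehat{\mathcal{P}_f}\,\mathcal{U}At$ in $\mathbf{Set}^{|\mathbf{L}|}$, $$p(n)(A)=\{\{B_1\tau,\dots,B_k\tau\}\mid (H\leftarrow B_1,\dots,B_k)\in\mathbb{P},\ A=H\tau,\ B_1\tau,\dots,B_k\tau\in At(n)\},$$ where $\tau$ ranges over substitutions of the clause's variables. Put $\mathcal{S}=\mathcal{K}\widehat{\mathcal{P}_c}\widehat{\mathcal{P}_f}\mathcal{U}:\mathbf{Set}^{\mathbf{L}}\to\mathbf{Set}^{\mathbf{L}}$ and $p^\sharp=\mathcal{K}(p)\circ\eta_{At}:At\to\mathcal{S}(At)$, i.e. $p^\sharp(n)(A)=\langle p(m)(A\sigma)\rangle_{\sigma:n\to m}$.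 Let $\omega:\Omega\to At\times\mathcal{S}(\Omega)$ be the final $At\times\mathcal{S}(\cdot)$-coalgebra in $\mathbf{Set}^{\mathbf{L}}$ (so $\Omega=\mathcal{C}(\mathcal{S})(At)$ is the carrier of the cofree $\mathcal{S}$-coalgebra on $At$). $[\![\cdot]\!]_{p^\sharp}:At\to\Omega$ is the unique $At\times\mathcal{S}(\cdot)$-coalgebra morphism from $(At,\langle id,p^\sharp\rangle)$ to $(\Omega,\omega)$; for $A\in At(n)$ one writes $[\![A]\!]_{p^\sharp}$ for $[\![\cdot]\!]_{p^\sharp}(n)(A)$. *)

(* Defs.v *)
From HB Require Import structures.
From mathcomp Require Import all_boot.
From mathcomp Require Import mathcomp_extra boolp classical_sets functions cardinality.

Set Implicit Arguments.
Unset Strict Implicit.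
Unset Printing Implicit Defensive.

Local Open Scope classical_set_scope.
#[local] Obligation Tactic := idtac.

Record category := Category {
  cat_ob :> Type;
  arr : cat_ob -> cat_ob -> Type;
  idarr : forall x, arr x x;
  arrcomp : forall x y z, arr y z -> arr x y -> arr x z;
  arrcomp1f : forall x y (f : arr x y), arrcomp (idarr y) f = f;
  arrcompf1 : forall x y (f : arr x y), arrcomp f (idarr x) = f;
  arrcompA : forall x y z t (h : arr z t) (g : arr y z) (f : arr x y),
    arrcomp h (arrcomp g f) = arrcomp (arrcomp h g) f }.

Arguments arr {c} _ _ : rename.
Arguments idarr {c} _ : rename.

Notation "g \oc f" := (arrcomp g f) (at level 50, left associativity).

Record functor (C D : category) := Functor {
  fun_ob :> C -> D;
  fmap : forall x y : C, arr x y -> arr (fun_ob x) (fun_ob y);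
  fmap1 : forall x : C, fmap (idarr x) = idarr (fun_ob x);
  fmapM : forall (x y z : C) (g : arr y z) (f : arr x y),
    fmap (g \oc f) = fmap g \oc fmap f }.

Arguments fmap {C D} _ {x y} _.

Record nat_trans (C D : category) (F G : functor C D) := NatTrans {
  component :> forall x : C, arr (F x) (G x);
  naturality : forall (x y : C) (f : arr x y),
    component y \oc fmap F f = fmap G f \oc component x }.

Lemma nat_trans_eq (C D : category) (F G : functor C D) (a b : nat_trans F G) :
  (forall x, a x = b x) -> a = b.
Proof.
case: a b => [a Ha] [b Hb] /= ab; have e : a = b by apply: functional_extensionality_dep.
by case: b / e Hb {ab} => Hb; rewrite (Prop_irrelevance Ha Hb).
Qed.

Section FunctorCategory.
Variables C D : category.

Program Definition nat_trans_id (F : functor C D) : nat_trans F F :=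
  NatTrans (component := fun x => idarr (F x)) _.
Next Obligation. by move=> F x y f; rewrite arrcomp1f arrcompf1. Qed.

Program Definition nat_trans_comp (F G H : functor C D)
    (b : nat_trans G H) (a : nat_trans F G) : nat_trans F H :=
  NatTrans (component := fun x => b x \oc a x) _.
Next Obligation.
by move=> F G H b a x y f; rewrite -arrcompA naturality !arrcompA naturality.
Qed.

Program Definition functor_category : category :=
  @Category (functor C D) (@nat_trans C D) nat_trans_id nat_trans_comp _ _ _.
Next Obligation. by move=> F G a; apply: nat_trans_eq => x; exact: arrcomp1f. Qed.
Next Obligation. by move=> F G a; apply: nat_trans_eq => x; exact: arrcompf1. Qed.
Next Obligation.
by move=> F G H K c b a; apply: nat_trans_eq => x; exact: arrcompA.
Qed.
End FunctorCategory.

Program Definition functor_comp (C D E : category) (G : functor D E)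
    (F : functor C D) : functor C E :=
  @Functor C E (fun x => G (F x)) (fun x y f => fmap G (fmap F f)) _ _.
Next Obligation. by move=> C D E G F x /=; rewrite !fmap1. Qed.
Next Obligation. by move=> C D E G F x y z g f /=; rewrite !fmapM. Qed.

Program Definition precomposition (C D E : category) (F : functor C D) :
    functor (functor_category D E) (functor_category C E) :=
  @Functor (functor_category D E) (functor_category C E)
    (fun G : functor D E => functor_comp G F)
    (fun G H (a : nat_trans G H) =>
       @NatTrans C E (functor_comp G F) (functor_comp H F) (fun x => a (F x)) _)
    _ _.
Next Obligation. by move=> C D E F G H a x y f; exact: (naturality a (fmap F f)). Qed.
Next Obligation. by move=> C D E F G; exact: nat_trans_eq. Qed.
Next Obligation. by move=> C D E F G H K b a; exact: nat_trans_eq. Qed.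

Program Definition postcomposition (C D E : category) (G : functor D E) :
    functor (functor_category C D) (functor_category C E) :=
  @Functor (functor_category C D) (functor_category C E)
    (fun F : functor C D => functor_comp G F)
    (fun F H (a : nat_trans F H) =>
       @NatTrans C E (functor_comp G F) (functor_comp G H)
         (fun x => fmap G (a x)) _)
    _ _.
Next Obligation.
by move=> C D E G F H a x y f /=; rewrite -!fmapM naturality.
Qed.
Next Obligation. by move=> C D E G F; apply: nat_trans_eq => x; exact: (fmap1 G (F x)). Qed.
Next Obligation.
by move=> C D E G F H K b a; apply: nat_trans_eq => x; exact: (fmapM G (b x) (a x)).
Qed.

Program Definition discrete (C : category) : category :=
  @Category C (fun x y => x = y) (fun x => erefl x)
    (fun x y z g f => etrans f g) _ _ _.
Next Obligation. by []. Qed.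
Next Obligation. by []. Qed.
Next Obligation. by []. Qed.

Program Definition discrete_inclusion (C : category) : functor (discrete C) C :=
  @Functor (discrete C) C (fun x => x)
    (fun x y (e : x = y) => match e in _ = z return @arr C x z with
                            | erefl => @idarr C x end) _ _.
Next Obligation. by []. Qed.
Next Obligation. by move=> C x y z g f; case: z / g; rewrite /= arrcomp1f. Qed.

Program Definition discrete_nat_trans (C D : category)
    (F G : functor (discrete C) D) (a : forall x : C, arr (F x) (G x)) :
    nat_trans F G := NatTrans (component := a) _.
Next Obligation.
move=> C D F G a x y e; case: y / e.
by rewrite (fmap1 F x) (fmap1 G x) arrcomp1f arrcompf1.
Qed.

Program Definition Sets : category :=
  @Category Type (fun X Y => X -> Y) (fun X x => x) (fun X Y Z g f x => g (f x))
    _ _ _.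
Next Obligation. by []. Qed.
Next Obligation. by []. Qed.
Next Obligation. by []. Qed.

Definition cpow (X : Type) : Type := {S : set X | countable S}.
Definition fpow (X : Type) : Type := {S : set X | finite_set S}.

Lemma countable_image (X Y : Type) (f : X -> Y) (S : set X) :
  countable S -> countable (f @` S).
Proof. exact/sub_countable/card_image_le. Qed.

Definition cpow_map (X Y : Type) (f : X -> Y) (S : cpow X) : cpow Y :=
  exist _ (f @` sval S) (countable_image f (svalP S)).
Definition fpow_map (X Y : Type) (f : X -> Y) (S : fpow X) : fpow Y :=
  exist _ (f @` sval S) (finite_image f (svalP S)).

Program Definition Pc : functor Sets Sets :=
  @Functor Sets Sets cpow cpow_map _ _.
Next Obligation.
by move=> X; apply: funext => -[S cS]; apply: eq_exist; exact: image_id.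
Qed.
Next Obligation.
move=> X Y Z g f; apply: funext => -[S cS]; apply: eq_exist => /=.
by rewrite -image_comp.
Qed.

Program Definition Pf : functor Sets Sets :=
  @Functor Sets Sets fpow fpow_map _ _.
Next Obligation.
by move=> X; apply: funext => -[S cS]; apply: eq_exist; exact: image_id.
Qed.
Next Obligation.
move=> X Y Z g f; apply: funext => -[S cS]; apply: eq_exist => /=.
by rewrite -image_comp.
Qed.

Record coalgebra (C : category) (F : functor C C) := Coalgebra {
  carrier :> C;
  struct : arr carrier (F carrier) }.

Definition coalg_morphism (C : category) (F : functor C C) (X Y : coalgebra F)
    (f : arr (X : C) (Y : C)) : Prop :=
  struct Y \oc f = fmap F f \oc struct X.
Arguments coalg_morphism {C F} X Y f.

Definition final (C : category) (F : functor C C) (Z : coalgebra F) : Prop :=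
  forall X : coalgebra F, exists! f : arr (X : C) (Z : C), coalg_morphism X Z f.

Definition final_map (C : category) (F : functor C C) (Z : coalgebra F)
    (Zfinal : final Z) (X : coalgebra F) : arr (X : C) (Z : C) :=
  sval (cid (Zfinal X)).

Section Labelled.
Variable C : category.
Let psh := functor_category C Sets.

Program Definition prod_presheaf (F G : functor C Sets) : functor C Sets :=
  @Functor C Sets (fun x => (F x * G x)%type)
    (fun x y f u => (fmap F f u.1, fmap G f u.2)) _ _.
Next Obligation. by move=> F G x; apply: funext => -[u v]; rewrite !fmap1. Qed.
Next Obligation.
by move=> F G x y z g f; apply: funext => -[u v]; rewrite !fmapM.
Qed.

Program Definition pairing (X F G : functor C Sets) (a : nat_trans X F)
    (b : nat_trans X G) : nat_trans X (prod_presheaf F G) :=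
  @NatTrans C Sets X (prod_presheaf F G) (fun x u => (a x u, b x u)) _.
Next Obligation.
move=> X F G a b x y f; apply: funext => u /=; congr pair.
- exact: (congr1 (@^~ u) (naturality a f)).
- exact: (congr1 (@^~ u) (naturality b f)).
Qed.

(* The endofunctor A x S(-) of Set^C. *)
Program Definition labelled (A : psh) (S : functor psh psh) : functor psh psh :=
  @Functor psh psh (fun X => prod_presheaf A (S X))
    (fun X Y (a : nat_trans X Y) =>
       @NatTrans C Sets (prod_presheaf A (S X)) (prod_presheaf A (S Y))
         (fun x u => (u.1, (fmap S a : nat_trans _ _) x u.2)) _) _ _.
Next Obligation.
move=> A S X Y a x y f; apply: funext => -[u v] /=; congr pair.
exact: (congr1 (@^~ v) (naturality (fmap S a : nat_trans _ _) f)).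
Qed.
Next Obligation.
move=> A S X; apply: nat_trans_eq => x; apply: funext => -[u v] /=.
by rewrite (fmap1 S X).
Qed.
Next Obligation.
move=> A S X Y Z b a; apply: nat_trans_eq => x; apply: funext => -[u v] /=.
by rewrite (fmapM S b a).
Qed.
End Labelled.

Record signature := Signature {
  fsymb : countType;
  farity : fsymb -> nat }.

Record alphabet := Alphabet {
  alph_sig :> signature;
  psymb : Type;
  parity : psymb -> nat }.

(* Terms with variables in V: V := 'I_n for the variables x_1, ..., x_n, and
   V := nat for the countable supply of variables used by clauses. *)
Inductive term (Sigma : signature) (V : Type) : Type :=
  | Var of V
  | App (f : fsymb Sigma) of 'I_(farity f) -> term Sigma V.
Arguments Var {Sigma V}.
Arguments App {Sigma V}.

Fixpoint tsubst (Sigma : signature) (V W : Type) (s : V -> term Sigma W)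
    (t : term Sigma V) : term Sigma W :=
  match t with
  | Var x => s x
  | App f a => App f (fun i => tsubst s (a i))
  end.

Lemma tsubst_Var (Sigma : signature) (V : Type) (t : term Sigma V) :
  tsubst Var t = t.
Proof. by elim: t => //= f a IH; congr App; exact: funext. Qed.

Lemma tsubstA (Sigma : signature) (U V W : Type) (s : V -> term Sigma W)
    (r : U -> term Sigma V) (t : term Sigma U) :
  tsubst s (tsubst r t) = tsubst (fun x => tsubst s (r x)) t.
Proof. by elim: t => //= f a IH; congr App; exact: funext. Qed.

Definition substitution (Sigma : signature) (n m : nat) : Type :=
  'I_n -> term Sigma 'I_m.

Program Definition Lawvere_op (Sigma : signature) : category :=
  @Category nat (substitution Sigma) (fun n => Var)
    (fun n m m' sigma theta => fun i => tsubst sigma (theta i)) _ _ _.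
Next Obligation. by move=> S n m f; apply: funext => i; exact: tsubst_Var. Qed.
Next Obligation. by []. Qed.
Next Obligation.
by move=> S n m k l h g f; apply: funext => i; rewrite tsubstA.
Qed.

Inductive atom (Alph : alphabet) (V : Type) : Type :=
  Atom (P : psymb Alph) of 'I_(parity P) -> term Alph V.
Arguments Atom {Alph V}.

Definition asubst (Alph : alphabet) (V W : Type) (s : V -> term Alph W)
    (A : atom Alph V) : atom Alph W :=
  let: Atom P a := A in Atom P (fun i => tsubst s (a i)).

Lemma asubst_Var (Alph : alphabet) (V : Type) (A : atom Alph V) :
  asubst Var A = A.
Proof.
by case: A => P a /=; congr Atom; apply: funext => i; exact: tsubst_Var.
Qed.

Lemma asubstA (Alph : alphabet) (U V W : Type) (s : V -> term Alph W)
    (r : U -> term Alph V) (A : atom Alph U) :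
  asubst s (asubst r A) = asubst (fun x => tsubst s (r x)) A.
Proof.
by case: A => P a /=; congr Atom; apply: funext => i; exact: tsubstA.
Qed.

Program Definition At (Alph : alphabet) : functor (Lawvere_op Alph) Sets :=
  @Functor (Lawvere_op Alph) Sets (fun n => atom Alph 'I_n)
    (fun n m theta A => asubst theta A) _ _.
Next Obligation. by move=> Alph n; apply: funext => A; exact: asubst_Var. Qed.
Next Obligation.
by move=> Alph n m k g f; apply: funext => A; rewrite /= asubstA.
Qed.

Definition atom_incl (Alph : alphabet) (n : nat) (A : atom Alph 'I_n) :
    atom Alph nat :=
  asubst (fun i : 'I_n => Var (i : nat)) A.

Record clause (Alph : alphabet) := Clause {
  head : atom Alph nat;
  body_size : nat;
  body : 'I_body_size -> atom Alph nat }.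

Definition program (Alph : alphabet) : Type :=
  {P : set (clause Alph) | finite_set P}.

(* The condition on S says S = {B_1 tau, ..., B_k tau}, and in particular that
   every B_i tau has its variables among x_1, ..., x_n. The substitution tau is
   total on nat, but only its values on the variables of the clause matter. *)
Definition resolvents (Alph : alphabet) (P : program Alph) (n : nat)
    (A : atom Alph 'I_n) : set (fpow (atom Alph 'I_n)) :=
  [set S | exists2 c, sval P c & exists tau : nat -> term Alph nat,
     atom_incl A = asubst tau (head c) /\
     @atom_incl Alph n @` sval S = range (fun i => asubst tau (@body Alph c i))].

Lemma existT_inj2 (I : Type) (T : I -> Type) (i : I) (x y : T i) :
  existT T i x = existT T i y -> x = y.
Proof.
by move=> e; have := projT2_eq e; rewrite (Prop_irrelevance (projT1_eq e) erefl).
Qed.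

Lemma tsubst_Var_inj (Sigma : signature) (V W : Type) (r : V -> W) :
  injective r -> injective (tsubst (fun x => Var (r x)) : term Sigma V -> _).
Proof.
move=> rI; elim=> [x|f a IH] [y|g b] //= => [[/rI->]//|].
case=> e; case: g / e b => b h; congr App.
by apply: funext => i; apply: IH; exact: (congr1 (@^~ i) (existT_inj2 h)).
Qed.

Lemma atom_incl_inj (Alph : alphabet) (n : nat) : injective (@atom_incl Alph n).
Proof.
case=> P a [Q b] [] e; case: Q / e b => b h; congr Atom.
apply: funext => i; apply: (@tsubst_Var_inj Alph _ _ (@nat_of_ord n) (@ord_inj n)).
exact: (congr1 (@^~ i) (existT_inj2 h)).
Qed.

Section ResolventsCountable.
Variable Alph : alphabet.

Fixpoint tcode (t : term Alph nat) : GenTree.tree nat :=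
  match t with
  | Var x => GenTree.Leaf x
  | App f a => GenTree.Node (pickle f) (map (fun i => tcode (a i)) (enum 'I_(farity f)))
  end.

Lemma tcode_inj : injective tcode.
Proof.
elim=> [x|f a IH] [y|g b] //= => [[->]//|] [/(pcan_inj pickleK) e].
case: g / e b => b /eq_in_map e; congr App; apply: funext => i.
by apply: IH; apply: e; rewrite mem_enum.
Qed.

Lemma tsubst_finite_support (t : term Alph nat) :
  exists N, forall s r : nat -> term Alph nat,
    (forall x, (x < N)%N -> s x = r x) -> tsubst s t = tsubst r t.
Proof.
elim: t => [x|f a /choice[N NP]] /=; first by exists x.+1 => s r; exact.
exists (\max_i N i) => s r sr; congr App; apply: funext => i.
by apply: NP => x xN; apply: sr; apply: leq_trans xN _; exact: leq_bigmax.
Qed.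

Lemma asubst_finite_support (A : atom Alph nat) :
  exists N, forall s r : nat -> term Alph nat,
    (forall x, (x < N)%N -> s x = r x) -> asubst s A = asubst r A.
Proof.
case: A => P a; have /choice[N NP] := fun i => tsubst_finite_support (a i).
exists (\max_i N i) => s r sr /=; congr Atom; apply: funext => i.
by apply: NP => x xN; apply: sr; apply: leq_trans xN _; exact: leq_bigmax.
Qed.

Lemma body_instances_countable (c : clause Alph) :
  countable (range (fun tau : nat -> term Alph nat =>
                      range (fun i => asubst tau (@body Alph c i)))).
Proof.
have /choice[N NP] := fun i => asubst_finite_support (@body Alph c i).
have /choice[d dP] : forall u, exists t, forall t', u = tcode t' -> t = t'.
  move=> u; case: (pselect (exists t, u = tcode t)) => [[t ->]|nt].
    by exists t => t' /tcode_inj.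
  by exists (Var 0) => t' ut'; case: nt; exists t'.
have := countable_image (fun s : seq (GenTree.tree nat) =>
  range (fun i => asubst (fun x => d (nth (GenTree.Leaf 0) s x)) (@body Alph c i)))
  (countableP setT).
apply: sub_countable; apply: subset_card_le => _ [tau _ <-].
exists (mkseq (fun x => tcode (tau x)) (\max_i N i)) => //.
congr (_ @` _); apply: funext => i; apply: NP => x xN; apply: dP.
by rewrite nth_mkseq //; apply: leq_trans xN _; exact: leq_bigmax.
Qed.

Lemma resolvents_countable (P : program Alph) (n : nat) (A : atom Alph 'I_n) :
  countable (resolvents P A).
Proof.
pose D := \bigcup_(c in sval P) range (fun tau : nat -> term Alph nat =>
                      range (fun i => asubst tau (@body Alph c i))).
have Dc : countable D.
  apply: bigcup_countable; first exact/finite_set_countable/(svalP P).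
  by move=> c _; exact: body_instances_countable.
case/countable_injP: Dc => f fI; apply/countable_injP.
exists (fun S => f (@atom_incl Alph n @` sval S)) => S S'.
have inD T : T \in resolvents P A -> @atom_incl Alph n @` sval T \in D.
  by rewrite !inE => -[c Pc [tau [_ ->]]]; exists c => //; exists tau.
move=> /inD SD /inD S'D /(fI _ _ SD S'D) e.
case: S S' e {SD S'D} => [S Sf] [S' S'f] /= e; apply: eq_exist.
by apply: funext => a; rewrite -(image_inj (@atom_incl_inj Alph n)) e
  (image_inj (@atom_incl_inj Alph n)).
Qed.

End ResolventsCountable.

Section Saturation.
Variable Alph : alphabet.

Let L := Lawvere_op Alph.
Let Set_L := functor_category L Sets.
Let Set_dL := functor_category (discrete L) Sets.

(* [forget] is U, [cofree] its right adjoint K, [cofree_unit] the unit eta,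
   [saturated_functor] is S, [program_coalg] is p and [saturated_coalg] is p^sharp. *)
Definition forget : functor Set_L Set_dL :=
  precomposition Sets (discrete_inclusion L).

Definition Pc_hat : functor Set_dL Set_dL := postcomposition (discrete L) Pc.
Definition Pf_hat : functor Set_dL Set_dL := postcomposition (discrete L) Pf.

Program Definition cofree_ob (F : functor (discrete L) Sets) : functor L Sets :=
  @Functor L Sets (fun n => forall (m : nat) (theta : substitution Alph n m), F m)
    (fun n m theta x => fun m' sigma => x m' (@arrcomp L n m m' sigma theta))
    _ _.
Next Obligation.
move=> F n; apply: funext => x; apply: functional_extensionality_dep => m.
by apply: funext => sigma; congr (x m _); exact: (@arrcompf1 L).
Qed.
Next Obligation.
move=> F n m k g f; apply: funext => x; apply: functional_extensionality_dep => m'.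
by apply: funext => sigma; congr (x m' _); exact: (@arrcompA L).
Qed.

Program Definition cofree : functor Set_dL Set_L :=
  @Functor Set_dL Set_L cofree_ob
    (fun F G (a : nat_trans F G) =>
       @NatTrans L Sets (cofree_ob F) (cofree_ob G)
         (fun n x => fun m theta => a m (x m theta)) _) _ _.
Next Obligation. by []. Qed.
Next Obligation. by move=> F; exact: nat_trans_eq. Qed.
Next Obligation. by move=> F G H b a; exact: nat_trans_eq. Qed.

Program Definition cofree_unit (G : Set_L) : nat_trans G (cofree (forget G)) :=
  @NatTrans L Sets G (cofree_ob (forget G))
    (fun n x => fun m theta => @fmap L Sets G n m theta x)
    _.
Next Obligation.
move=> G n m theta; apply: funext => x; apply: functional_extensionality_dep => k.
by apply: funext => sigma; rewrite /= fmapM.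
Qed.

Definition saturated_functor : functor Set_L Set_L :=
  functor_comp cofree (functor_comp Pc_hat (functor_comp Pf_hat forget)).

Variable P : program Alph.

Definition program_coalg :
    nat_trans (forget (At Alph)) (Pc_hat (Pf_hat (forget (At Alph)))) :=
  @discrete_nat_trans L Sets (forget (At Alph)) (Pc_hat (Pf_hat (forget (At Alph))))
    (fun n A => exist _ (resolvents P A) (resolvents_countable P A)).

Definition saturated_coalg : nat_trans (At Alph) (saturated_functor (At Alph)) :=
  nat_trans_comp (fmap cofree program_coalg : nat_trans _ _) (cofree_unit (At Alph)).

Definition labelled_saturated : functor Set_L Set_L :=
  labelled (At Alph) saturated_functor.

Definition At_coalgebra : coalgebra labelled_saturated :=
  @Coalgebra Set_L labelled_saturated (At Alph)
    (pairing (nat_trans_id (At Alph)) saturated_coalg).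

Definition saturated_semantics (Omega : coalgebra labelled_saturated)
    (Omega_final : final Omega) :
    nat_trans (At Alph) (carrier Omega : functor L Sets) :=
  final_map Omega_final At_coalgebra.

End Saturation.

(* [final_coalgebra_exists] below: the final coalgebra of [labelled_saturated] is
   realised by possibly infinite trees modulo bisimilarity. *)

Section EgliMilner.

Definition egli_milner (X Y : Type) (R : X -> Y -> Prop) (S : set X) (T : set Y) :=
  (forall x, S x -> exists2 y, T y & R x y) /\
  (forall y, T y -> exists2 x, S x & R x y).

Lemma egli_milner_sub (X Y : Type) (R R' : X -> Y -> Prop) S T :
  (forall x y, R x y -> R' x y) -> egli_milner R S T -> egli_milner R' S T.
Proof.
move=> RR' [h1 h2]; split=> [x /h1|y /h2] [z ? ?]; exists z => //; exact: RR'.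
Qed.

Lemma egli_milner_refl (X : Type) (R : X -> X -> Prop) S :
  (forall x, R x x) -> egli_milner R S S.
Proof. by move=> Rr; split=> x Sx; exists x. Qed.

Lemma egli_milner_sym (X : Type) (R : X -> X -> Prop) S T :
  egli_milner R S T -> egli_milner (fun y x => R x y) T S.
Proof. by case. Qed.

Lemma egli_milner_trans (X : Type) (R Q : X -> X -> Prop) S T U :
  egli_milner R S T -> egli_milner Q T U ->
  egli_milner (fun x z => exists y, R x y /\ Q y z) S U.
Proof.
move=> [h1 h2] [k1 k2]; split=> [x /h1[y /k1[z Uz yz] xy]|z /k2[y /h2[x Sx xy] yz]].
- by exists z => //; exists y.
- by exists x => //; exists y.
Qed.

Lemma egli_milner_image (X Z : Type) (f : X -> Z) S T :
  egli_milner (fun x y => f x = f y) S T -> f @` S = f @` T.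
Proof.
move=> [h1 h2]; apply/seteqP; split=> _ [x /= xS <-].
- by have [y Ty ->] := h1 _ xS; exists y.
- by have [y Ty <-] := h2 _ xS; exists y.
Qed.

Lemma egli_milner_span (X X' Y Z Z' : Type) (f : X -> Z) (g : Y -> Z)
    (f' : X' -> Z') (g' : Y -> Z') S S' U :
  f @` S = g @` U -> f' @` S' = g' @` U ->
  egli_milner (fun x x' => exists y, f x = g y /\ f' x' = g' y) S S'.
Proof.
move=> e e'; split=> [x Sx|x' Sx'].
- have [y Uy gy] : (g @` U) (f x) by rewrite -e; exists x.
  have [x' Sx' fx'] : (f' @` S') (g' y) by rewrite e'; exists y.
  by exists x' => //; exists y; rewrite fx'.
- have [y Uy gy] : (g' @` U) (f' x') by rewrite -e'; exists x'.
  have [x Sx fx] : (f @` S) (g y) by rewrite e; exists y.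
  by exists x => //; exists y; rewrite fx.
Qed.

End EgliMilner.

Section FinalExists.
Variable Alph : alphabet.

Let L := Lawvere_op Alph.
Let Set_L := functor_category L Sets.
Let F := labelled_saturated Alph.

(* For each substitution a node has a sequence (with gaps) of finite sequences of
   subtrees, enumerating a countable set of finite sets. *)
CoInductive tree (n : nat) : Type := Node {
  label : atom Alph 'I_n;
  branching : forall m, substitution Alph n m -> nat -> option nat;
  subtree : forall m (theta : substitution Alph n m) k,
    'I_(odflt 0 (branching theta k)) -> tree m }.

Definition children n (t : tree n) m (theta : substitution Alph n m) :
    cpow (fpow (tree m)) :=
  exist (fun S : set _ => countable S) _ (countable_image
    (fun k => exist _ (range (@subtree n t m theta k)) (finite_image _ finite_finset) :
                fpow (tree m))
    (countableP [set k | branching t theta k])).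

Definition csets X (T : cpow (fpow X)) : set (set X) := sval @` sval T.

Lemma csets_inj X : injective (@csets X).
Proof.
move=> [T Tc] [T' T'c]; rewrite /csets /= => e; apply: eq_exist; apply: funext => S.
have I : injective (sval : fpow X -> set X).
  by move=> [U Uf] [V Vf] /= UV; exact: eq_exist.
by rewrite -(image_inj I) e (image_inj I).
Qed.

Lemma csets_map X Y (f : X -> Y) (T : cpow (fpow X)) :
  csets (cpow_map (fpow_map f) T) = image^~ f @` csets T.
Proof. by rewrite /csets /= !image_comp. Qed.


Lemma finite_set_enum X (S : set X) :
  finite_set S -> exists n (c : 'I_n -> X), range c = S.
Proof.
elim/Pchoice: X S => X S /finite_seqP[s ->]; exists (size s), (tnth (in_tuple s)).
apply/seteqP; split=> [_ [i _ <-]|x xs] /=; first exact: mem_tnth.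
by have /tnthP[i ->] : x \in in_tuple s by []; exists i.
Qed.

Lemma cpow_fpow_enum X (T : cpow (fpow X)) :
  exists (s : nat -> option nat) (c : forall k, 'I_(odflt 0 (s k)) -> X),
    csets T = [set range (c k) | k in [set k | s k]].
Proof.
case/countable_injP: (svalP T) => f fI.
have /choice[sc scP] k : exists sc : {s : option nat & 'I_(odflt 0 s) -> X},
    (forall S, sval T S -> f S = k -> tag sc /\ range (tagged sc) = sval S) /\
    (tag sc -> exists2 S, sval T S & range (tagged sc) = sval S).
  have [[S [TS <-]]|nS] := pselect (exists S, sval T S /\ f S = k).
    have [n [c cS]] := finite_set_enum (svalP S).
    exists (existT (fun s : option nat => 'I_(odflt 0 s) -> X) (Some n) c).
    split=> [S' TS' SS'|_]; last by exists S.
    by have -> : S' = S by apply: fI; rewrite ?inE.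
  have c : 'I_(odflt 0 (None : option nat)) -> X by case.
  exists (existT (fun s : option nat => 'I_(odflt 0 s) -> X) None c).
  by split=> // S TS Sk; case: nS; exists S.
exists (fun k => tag (sc k)), (fun k => tagged (sc k)).
apply/seteqP; split=> [_ [S TS <-]|_ [k /= sk <-]].
  by have [h _] := scP (f S); have [? <-] := h S TS erefl; exists (f S).
by have [_ /(_ sk)[S TS ->]] := scP k; exists S.
Qed.

Definition step (R : forall n, tree n -> tree n -> Prop) n (t u : tree n) : Prop :=
  label t = label u /\
  forall m (theta : substitution Alph n m),
    egli_milner (egli_milner (R m)) (csets (children t theta))
                                    (csets (children u theta)).

Definition bisim n (t u : tree n) : Prop :=
  exists2 R : forall n, tree n -> tree n -> Prop,
    (forall n t u, R n t u -> step R t u) & R n t u.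

Lemma step_sub (R R' : forall n, tree n -> tree n -> Prop) n (t u : tree n) :
  (forall n t u, R n t u -> R' n t u) -> step R t u -> step R' t u.
Proof.
move=> RR' [e h]; split=> // m theta; apply: egli_milner_sub (h m theta) => S T.
exact/egli_milner_sub/RR'.
Qed.

Lemma bisim_step n (t u : tree n) : bisim t u -> step bisim t u.
Proof.
by move=> [R RP /RP]; apply: step_sub => k v w Rvw; exists R.
Qed.

Lemma step_bisim n (t u : tree n) : step bisim t u -> bisim t u.
Proof.
move=> h; exists (fun n t u => step bisim t u) => // k v w.
by apply: step_sub; exact: bisim_step.
Qed.

Lemma bisim_refl n (t : tree n) : bisim t t.
Proof.
exists (fun _ t u => t = u) => // k v _ <-; split=> // m theta.
by apply: egli_milner_refl => S; exact: egli_milner_refl.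
Qed.

Lemma bisim_sym n (t u : tree n) : bisim t u -> bisim u t.
Proof.
move=> tu; exists (fun n t u => bisim u t) => // k v w /bisim_step[e h].
split=> // m theta; apply: egli_milner_sub (egli_milner_sym (h m theta)) => S T.
exact: egli_milner_sym.
Qed.

Lemma bisim_trans n (t u v : tree n) : bisim t u -> bisim u v -> bisim t v.
Proof.
move=> tu uv; exists (fun n t v => exists u, bisim t u /\ bisim u v); last by exists u.
move=> k a c [b [/bisim_step[e h] /bisim_step[e' h']]].
split=> [|m theta]; first by rewrite e.
apply: egli_milner_sub (egli_milner_trans (h m theta) (h' m theta)) => S T [U [SU UT]].
exact: egli_milner_trans SU UT.
Qed.

Definition omega_ob (n : nat) : Type := {C : set (tree n) | exists t, C = bisim t}.

Definition cls n (t : tree n) : omega_ob n := exist _ (bisim t) (ex_intro _ t erefl).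

Definition rep n (C : omega_ob n) : tree n := sval (cid (svalP C)).

Lemma repK n (C : omega_ob n) : cls (rep C) = C.
Proof.
by case: C => C HC; apply: eq_exist; rewrite /rep /=; case: cid.
Qed.

Lemma cls_eq n (t u : tree n) : bisim t u -> cls t = cls u.
Proof.
move=> tu; apply: eq_exist; apply: funext => v; apply/propext; split.
- by apply: bisim_trans; exact: bisim_sym.
- exact: bisim_trans.
Qed.

Lemma eq_cls n (t u : tree n) : cls t = cls u -> bisim t u.
Proof. by move=> [->]; exact: bisim_refl. Qed.

Lemma rep_cls n (t : tree n) : bisim (rep (cls t)) t.
Proof. by apply: eq_cls; rewrite repK. Qed.

Lemma cls_children n (t u : tree n) m (theta : substitution Alph n m) :
  bisim t u ->
  cpow_map (fpow_map (@cls m)) (children t theta) =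
  cpow_map (fpow_map (@cls m)) (children u theta).
Proof.
move=> /bisim_step[_ h]; apply: csets_inj; rewrite !csets_map.
apply: egli_milner_image; apply: egli_milner_sub (h m theta) => S T ST.
by apply: egli_milner_image; apply: egli_milner_sub ST => a b; exact: cls_eq.
Qed.

Definition reindex n m (theta : substitution Alph n m) (t : tree n) : tree m :=
  @Node m (asubst theta (label t))
    (fun m' sigma => @branching n t m' (@arrcomp L n m m' sigma theta))
    (fun m' sigma => @subtree n t m' (@arrcomp L n m m' sigma theta)).

Lemma bisim_intro n (t u : tree n) :
  label t = label u ->
  (forall m (theta : substitution Alph n m), children t theta = children u theta) ->
  bisim t u.
Proof.
move=> e h; apply: step_bisim; split=> // m theta; rewrite h.
apply: egli_milner_refl => S; apply: egli_milner_refl => v; exact: bisim_refl.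
Qed.

Lemma reindex_bisim n m (theta : substitution Alph n m) (t u : tree n) :
  bisim t u -> bisim (reindex theta t) (reindex theta u).
Proof.
move=> /bisim_step[e h]; apply: step_bisim; split=> [|k sigma]; first by rewrite /= e.
exact: h.
Qed.

Program Definition omega_presheaf : functor L Sets :=
  @Functor L Sets omega_ob (fun n m theta C => cls (reindex theta (rep C))) _ _.
Next Obligation.
move=> n; apply: funext => C; rewrite -[RHS]repK; apply: cls_eq; apply: bisim_intro.
  exact: asubst_Var.
by move=> m theta; exact: (congr1 (@children n (rep C) m) (@arrcompf1 L n m theta)).
Qed.
Next Obligation.
move=> n m k g f; apply: funext => C; apply: cls_eq.
apply: (@bisim_trans _ _ (reindex g (reindex f (rep C)))).
  apply: bisim_intro; first by rewrite /= asubstA.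
  by move=> k' h; exact: (congr1 (@children n (rep C) k') (@arrcompA L _ _ _ _ h g f)).
exact/reindex_bisim/bisim_sym/rep_cls.
Qed.


Definition omega_struct_fun n (C : omega_ob n) :
    labelled_saturated Alph omega_presheaf n :=
  (label (rep C),
   fun m theta => cpow_map (fpow_map (@cls m)) (children (rep C) theta)).

Lemma omega_struct_cls n (t : tree n) :
  omega_struct_fun (cls t) =
  (label t, fun m theta => cpow_map (fpow_map (@cls m)) (children t theta)).
Proof.
have rt := rep_cls t; congr pair; first by have [] := bisim_step rt.
apply: functional_extensionality_dep => m; apply: funext => theta.
exact: cls_children.
Qed.

Program Definition omega_struct :
    nat_trans omega_presheaf (labelled_saturated Alph omega_presheaf) :=
  @NatTrans L Sets omega_presheaf (labelled_saturated Alph omega_presheaf)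
    omega_struct_fun _.
Next Obligation.
move=> n m theta; apply: funext => C.
exact: (omega_struct_cls (reindex theta (rep C))).
Qed.

Definition omega_coalgebra : coalgebra (labelled_saturated Alph) :=
  @Coalgebra Set_L (labelled_saturated Alph) omega_presheaf omega_struct.

Section Unfold.
Variable X : coalgebra (labelled_saturated Alph).
Let XF : functor L Sets := carrier X.
Let xi : nat_trans XF (labelled_saturated Alph XF) := struct X.

Let succ n (x : XF n) m (theta : substitution Alph n m) : cpow (fpow (XF m)) :=
  (xi n x).2 m theta.

Let enum_seq n (x : XF n) : {s : forall m, substitution Alph n m -> nat -> option nat &
  {c : forall m (theta : substitution Alph n m) k, 'I_(odflt 0 (s m theta k)) -> XF m |
    forall m (theta : substitution Alph n m),
      csets (succ x theta) = [set range (c m theta k) | k in [set k | s m theta k]]}}.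
Proof.
have e m (theta : substitution Alph n m) := cpow_fpow_enum (succ x theta).
pose s m theta := sval (cid (e m theta)).
exists s; exists (fun m theta => sval (cid (svalP (cid (e m theta))))) => m theta.
exact: svalP (cid (svalP (cid (e m theta)))).
Qed.

CoFixpoint unfold_tree n (x : XF n) : tree n :=
  @Node n (xi n x).1 (projT1 (enum_seq x))
    (fun m theta k i => unfold_tree (sval (projT2 (enum_seq x)) m theta k i)).

Lemma unfold_children n (x : XF n) m (theta : substitution Alph n m) :
  children (unfold_tree x) theta = cpow_map (fpow_map (@unfold_tree m)) (succ x theta).
Proof.
apply: csets_inj; rewrite csets_map (svalP (projT2 (enum_seq x))).
rewrite /csets /= !image_comp; apply: eq_imagel => k _ /=.
by rewrite image_comp.
Qed.

Lemma unfold_natural n m (theta : arr (n : L) m) (x : XF n) :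
  cls (unfold_tree (fmap XF theta x)) =
  fmap omega_presheaf theta (cls (unfold_tree x)).
Proof.
have xiN := congr1 (@^~ x) (naturality xi theta).
apply: cls_eq; apply: bisim_trans (reindex_bisim _ (bisim_sym (rep_cls _))).
apply: bisim_intro; first exact: (congr1 fst xiN).
move=> k sigma; rewrite unfold_children.
rewrite -[RHS]/(children (unfold_tree x) (@arrcomp L n m k sigma theta)).
rewrite unfold_children; congr cpow_map.
exact: (congr1 (fun u => u.2 k sigma) xiN).
Qed.

Program Definition unfold : nat_trans XF omega_presheaf :=
  @NatTrans L Sets XF omega_presheaf (fun n x => cls (unfold_tree x)) _.
Next Obligation. by move=> n m theta; apply: funext => x; exact: unfold_natural. Qed.

Lemma unfold_morphism : coalg_morphism X omega_coalgebra unfold.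
Proof.
apply: nat_trans_eq => n; apply: funext => x.
rewrite [LHS](omega_struct_cls (unfold_tree x)); congr pair.
apply: functional_extensionality_dep => m; apply: funext => theta.
rewrite unfold_children; apply: csets_inj; rewrite !csets_map image_comp /=.
by rewrite /csets /= !image_comp; apply: eq_imagel => S _ /=; rewrite !image_comp.
Qed.

Lemma coalg_morphism_unique (g h : nat_trans XF omega_presheaf) :
  coalg_morphism X omega_coalgebra g -> coalg_morphism X omega_coalgebra h -> g = h.
Proof.
move=> gX hX.
have out (f : nat_trans XF omega_presheaf) : coalg_morphism X omega_coalgebra f ->
    forall n (x : XF n) t, cls t = f n x ->
      label t = (xi n x).1 /\
      forall m (theta : substitution Alph n m),
        image^~ (@cls m) @` csets (children t theta) =
        image^~ (f m) @` csets (succ x theta).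
  move=> fX n x t tx.
  have := congr1 (fun a : nat_trans XF (labelled_saturated Alph omega_presheaf) => a n x) fX.
  rewrite /= -tx omega_struct_cls => e; split; first exact: (congr1 fst e).
  move=> m theta; rewrite -!csets_map; congr csets.
  exact: (congr1 (fun u => u.2 m theta) e).
apply: nat_trans_eq => n; apply: funext => x.
rewrite -[LHS]repK -[RHS]repK; apply: cls_eq.
exists (fun n t u => exists x : XF n, cls t = g n x /\ cls u = h n x); last first.
  by exists x; rewrite !repK.
move=> k t u [y [ty uy]].
have [lt ct] := out g gX _ _ _ ty; have [lu cu] := out h hX _ _ _ uy.
split=> [|m theta]; first by rewrite lt lu.
apply: egli_milner_sub (egli_milner_span (ct m theta) (cu m theta)) => S T [U [SU TU]].
exact: egli_milner_span SU TU.
Qed.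

End Unfold.

Theorem final_coalgebra_exists : exists Omega : coalgebra (labelled_saturated Alph), final Omega.
Proof.
exists omega_coalgebra => X; exists (unfold X); split; first exact: unfold_morphism.
by move=> f fX; apply: coalg_morphism_unique fX; exact: unfold_morphism.
Qed.

End FinalExists.

(* Main.v *)
Require Import Defs.
From mathcomp Require Import all_boot.

Theorem theorem4p8 (Alph : alphabet) (P : program Alph)
    (Omega : coalgebra (labelled_saturated Alph)) (Omega_final : final Omega)
    (n m : Lawvere_op Alph) (A : At Alph n) (theta : arr n m) :
  saturated_semantics P Omega_final m (fmap (At Alph) theta A) =
  fmap (carrier Omega : functor (Lawvere_op Alph) Sets) theta
    (saturated_semantics P Omega_final n A).
Proof.
(* Saturation makes the program a coalgebra in presheaves over all of [Lawvere_op Alph], not just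
   over its discrete part, so the final map is natural in every substitution. Compositionality is
   its naturality square at [theta], an equality of functions in [Sets], evaluated at the atom
   [A]. *)
exact: (congr1 (@^~ A) (naturality (saturated_semantics P Omega_final) theta)).
Qed.
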